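(* A separation system $\vec S$ can be implemented by set separations if and only if it is scrupulous.
   Context: A separation system is a poset $\vec S$ together with an order-reversing involution $\vec s\mapsto\vec s^{\,*}$ (i.e. $\vec r\le\vec s$ implies $\vec s^{\,*}\le\vec r^{\,*}$). An element $\vec s$ is small if $\vec s\le\vec s^{\,*}$. $\vec S$ is scrupulous if $\vec r\le\vec s^{\,*}$ for every pair $\vec r,\vec s$ of small elements of $\vec S$. A homomorphism of separation systems $f\colon\vec S\to\vec S'$ is an order-preserving map with $f(\vec s^{\,*})=f(\vec s)^*$ for all $\vec s$; an isomorphism is a bijective homomorphism whose inverse is also a homomorphism. For a set $V$, $\mathcal{S}(V)$ is the separation system of all pairs $(A,B)$ of subsets of $V$ with $A\cup B=V$, with involution $(A,B)^*=(B,A)$ and order $(A,B)\le(C,D)$ iff $A\subseteq C$ and $D\subseteq B$. A sub-system of $\mathcal{S}(V)$ is a subset closed under the involution, with the induced order. $\vec S$ can be implemented by set separations if there are a set $V$ and a sub-system of $\mathcal{S}(V)$ isomorphic to $\vec S$. *)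

(* Defs.v *)
From HB Require Import structures.
From mathcomp Require Import all_boot all_order.
From mathcomp Require Import boolp classical_sets.

Set Implicit Arguments.
Unset Strict Implicit.
Unset Printing Implicit Defensive.

Import Order.TTheory.

Local Open Scope classical_set_scope.
Local Open Scope order_scope.

(* [porderType] carries a choice structure and a bool-valued order; with the
   classical axioms of [boolp] every type with a partial order in [Prop] has
   both, so working over it excludes no poset. *)
HB.mixin Record isSeparationSystem (d : Order.disp_t) S of Order.POrder d S := {
  sinv : S -> S;
  sinvK : involutive sinv;
  le_sinv : {homo sinv : r s / r <= s >-> s <= r}
}.

#[short(type="separationSystemType")]
HB.structure Definition SeparationSystem (d : Order.disp_t) :=
  { S of Order.POrder d S & isSeparationSystem d S }.

Definition small (d : Order.disp_t) (S : separationSystemType d) (s : S)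
  : Prop := s <= sinv s.

Definition scrupulous (d : Order.disp_t) (S : separationSystemType d) : Prop :=
  forall r s : S, small r -> small s -> r <= sinv s.

Definition sep_hom (d d' : Order.disp_t) (S : separationSystemType d)
    (S' : separationSystemType d') (f : S -> S') : Prop :=
  {homo f : r s / r <= s} /\ {morph f : s / sinv s}.

Definition isomorphic (d d' : Order.disp_t) (S : separationSystemType d)
    (S' : separationSystemType d') : Prop :=
  exists (f : S -> S') (g : S' -> S),
    [/\ cancel f g, cancel g f, sep_hom f & sep_hom g].

Record subsystem (d : Order.disp_t) (S : separationSystemType d) := SubSystem {
  subsystem_set : set S;
  subsystem_sinv : forall s, subsystem_set s -> subsystem_set (sinv s)
}.

Section SubSystem.
Context {d : Order.disp_t} {S : separationSystemType d}.
Variable A : subsystem S.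

Record subsystem_type := SubSystemType {
  subsystem_val : S;
  subsystem_valP : subsystem_val \in subsystem_set A
}.

HB.instance Definition _ := [isSub of subsystem_type for subsystem_val].
HB.instance Definition _ := [Choice of subsystem_type by <:].

Implicit Types x y : subsystem_type.

Definition subsystem_le x y : bool := subsystem_val x <= subsystem_val y.

Lemma subsystem_le_refl : reflexive subsystem_le.
Proof. by move=> x; exact: lexx. Qed.

Lemma subsystem_le_anti : antisymmetric subsystem_le.
Proof. by move=> x y /le_anti; exact: val_inj. Qed.

Lemma subsystem_le_trans : transitive subsystem_le.
Proof. by move=> y x z; exact: le_trans. Qed.

HB.instance Definition _ := Order.Le_isPOrder.Build d subsystem_type
  subsystem_le_refl subsystem_le_anti subsystem_le_trans.

Definition subsystem_inv x : subsystem_type :=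
  SubSystemType (mem_set (subsystem_sinv (set_mem (subsystem_valP x)))).

Lemma subsystem_invK : involutive subsystem_inv.
Proof. by move=> x; apply: val_inj; exact: sinvK. Qed.

Lemma le_subsystem_inv : {homo subsystem_inv : x y / x <= y >-> y <= x}.
Proof. by move=> x y; exact: le_sinv. Qed.

HB.instance Definition _ := isSeparationSystem.Build d subsystem_type
  subsystem_invK le_subsystem_inv.

End SubSystem.

Record set_separation (V : Type) := SetSeparation {
  left_side : set V;
  right_side : set V;
  sidesU : left_side `|` right_side = [set: V]
}.

Fact setsep_display : Order.disp_t. Proof. exact: Order.Disp tt tt. Qed.

Section SetSeparation.
Context {V : Type}.
Implicit Types s t : set_separation V.

HB.instance Definition _ := gen_eqMixin (set_separation V).
HB.instance Definition _ := gen_choiceMixin (set_separation V).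

Definition setsep_le s t : bool :=
  `[< left_side s `<=` left_side t /\ right_side t `<=` right_side s >].

Lemma setsep_eq s t :
  left_side s = left_side t -> right_side s = right_side t -> s = t.
Proof.
case: s t => [A B sU] [C D tU] /= eqAC eqBD.
by subst C D; congr SetSeparation; exact: Prop_irrelevance.
Qed.

Lemma setsep_le_refl : reflexive setsep_le.
Proof. by move=> s; apply/asboolP; split. Qed.

Lemma setsep_le_anti : antisymmetric setsep_le.
Proof.
move=> s t /andP[/asboolP[st ts] /asboolP[st' ts']].
by apply: setsep_eq; apply/seteqP.
Qed.

Lemma setsep_le_trans : transitive setsep_le.
Proof.
move=> t s u /asboolP[st ts] /asboolP[tu ut]; apply/asboolP.
by split; [exact: subset_trans tu | exact: subset_trans ts].
Qed.

HB.instance Definition _ := Order.Le_isPOrder.Build setsep_display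
  (set_separation V) setsep_le_refl setsep_le_anti setsep_le_trans.

Definition setsep_inv s : set_separation V :=
  SetSeparation (etrans (setUC (right_side s) (left_side s)) (sidesU s)).

Lemma setsep_invK : involutive setsep_inv.
Proof. by move=> s; exact: setsep_eq. Qed.

Lemma le_setsep_inv : {homo setsep_inv : s t / s <= t >-> t <= s}.
Proof. by move=> s t /asboolP[st ts]; apply/asboolP; split. Qed.

HB.instance Definition _ := isSeparationSystem.Build setsep_display
  (set_separation V) setsep_invK le_setsep_inv.

End SetSeparation.

Definition implementable (d : Order.disp_t) (S : separationSystemType d)
  : Prop :=
  exists (V : Type) (A : subsystem (set_separation V)),
    isomorphic S (subsystem_type A).

(* Main.v *)
Require Import Defs.
From mathcomp Require Import all_boot all_order.
From mathcomp Require Import boolp classical_sets.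

(** A small set separation has the form [(A, V)], so set separations are
    scrupulous.  Conversely, call [v] a point if its inverse is not small, and
    send [s] to the separation whose left side consists of the points [v] with
    [~ s <= v] and whose right side is the left side of the inverse of [s]; the
    sides cover [V] because [s, s^* <= v] would give [v^* <= s^* <= v].  If
    [~ r <= s], then either [s] is a point, which lies in the left side of [r]
    but not of [s], or [r^*] is one, which lies in the right side of [s] but not
    of [r]; if neither were a point, [r] and [s^*] would both be small, and
    scrupulousness would give [r <= s]. *)

Set Implicit Arguments.
Unset Strict Implicit.
Unset Printing Implicit Defensive.

Import Order.TTheory.

Local Open Scope classical_set_scope.
Local Open Scope order_scope.

Lemma sinv_leC (d : Order.disp_t) (S : separationSystemType d) (r s : S) :
  (sinv r <= s) = (sinv s <= r).
Proof. by apply/idP/idP => /le_sinv; rewrite sinvK. Qed.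

(** Smallness puts the left side inside the right side, which is then already the union of the
    two. *)
Lemma small_setsepP (V : Type) (s : set_separation V) :
  small s <-> right_side s = [set: V].
Proof.
split=> [/asboolP[/= AB _]|sV].
  by rewrite -(sidesU s); apply/esym/setUidPr.
by apply/asboolP; rewrite /= sV; split; exact: subsetT.
Qed.

Lemma scrupulous_setsep (V : Type) : scrupulous (set_separation V).
Proof.
move=> r s /small_setsepP rV /small_setsepP sV.
by apply/asboolP; rewrite /= rV sV; split; exact: subsetT.
Qed.

Lemma scrupulous_subsystem (d : Order.disp_t) (S : separationSystemType d)
  (A : subsystem S) : scrupulous S -> scrupulous (subsystem_type A).
Proof. by move=> scrS x y sx sy; exact: scrS sx sy. Qed.

(** The map to [S'] preserves smallness, and its inverse carries the resulting inequality back to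
    [S]. *)
Lemma scrupulous_isomorphic (d d' : Order.disp_t) (S : separationSystemType d)
  (S' : separationSystemType d') :
  isomorphic S S' -> scrupulous S' -> scrupulous S.
Proof.
move=> [f [g [fK _ [f_le fV] [g_le gV]]]] scrS' r s sr ss.
have f_small t : small t -> small (f t) by move=> /f_le; rewrite fV.
by have /g_le := scrS' _ _ (f_small _ sr) (f_small _ ss); rewrite gV !fK.
Qed.

Section EmbeddingImage.
Context {d d' : Order.disp_t} {S : separationSystemType d}
  {S' : separationSystemType d'}.
Variable f : S -> S'.
Hypotheses (f_le : {mono f : r s / r <= s}) (fV : {morph f : s / sinv s}).

Lemma range_sinv t : range f t -> range f (sinv t).
Proof. by move=> [s _ <-]; exists (sinv s). Qed.

(** Reduces implementability to finding a map into set separations that preserves and reflects the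
    order and commutes with the involution. *)
Lemma isomorphic_range : isomorphic S (subsystem_type (SubSystem range_sinv)).
Proof.
pose A := SubSystem range_sinv.
have memA s : f s \in subsystem_set A by apply/mem_set; exists s.
pose h s : subsystem_type A := SubSystemType (memA s).
have h_surj (x : subsystem_type A) : {s | h s = x}.
  apply: cid; have [s _ fs] := set_mem (subsystem_valP x).
  by exists s; exact: val_inj.
have h_le : {mono h : r s / r <= s} by move=> r s; exact: f_le.
have hV : {morph h : s / sinv s} by move=> s; apply: val_inj; exact: fV.
pose g x := sval (h_surj x).
have gK : cancel g h by move=> x; exact: svalP (h_surj x).
have hK : cancel h g.
  (* Reflecting the order forces [h] to be injective, by antisymmetry. *)
  by move=> s; apply/le_anti; rewrite -!h_le gK !lexx.
exists h, g; split=> //; split=> //.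
- by move=> r s; rewrite h_le.
- by move=> x y; rewrite -h_le !gK.
- by move=> x; rewrite -[in LHS](gK x) -hV hK.
Qed.

End EmbeddingImage.

Section PointRepresentation.
Context {d : Order.disp_t} {S : separationSystemType d}.

(** The condition is the negation of [small (sinv v)], simplified by [sinvK]. *)
Definition point := {v : S | ~~ (sinv v <= v)}.

Definition points_not_above (s : S) : set point := [set v | ~~ (s <= sval v)].

Lemma points_not_aboveU s :
  points_not_above s `|` points_not_above (sinv s) = [set: point].
Proof.
apply/seteqP; split=> // v _; rewrite /points_not_above /=.
apply/orP; rewrite -negb_and; apply: contra (svalP v) => /andP[sv].
by rewrite sinv_leC => vs; exact: le_trans vs sv.
Qed.

Definition point_separation (s : S) : set_separation point :=
  SetSeparation (points_not_aboveU s).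

Lemma point_separationV : {morph point_separation : s / sinv s}.
Proof. by move=> s; apply: setsep_eq; rewrite //= sinvK. Qed.

Lemma points_not_above_le r s :
  r <= s -> points_not_above r `<=` points_not_above s.
Proof. by move=> rs v; apply: contra; exact: le_trans. Qed.

Lemma point_separation_le :
  scrupulous S -> {mono point_separation : r s / r <= s}.
Proof.
move=> scrS r s; apply/idP/idP => [/asboolP[/= rs sr]|rs]; last first.
  by apply/asboolP; split; apply: points_not_above_le; rewrite ?le_sinv.
apply/negPn/negP => nrs.
have [ss|ns] := boolP (sinv s <= s); last first.
  by have := rs (exist _ s ns) nrs; rewrite /points_not_above /= lexx.
have [sr'|nr] := boolP (r <= sinv r).
  by case/negP: nrs; rewrite -[s]sinvK; apply: scrS; rewrite /small ?sinvK.
(* In this form [nr] says that [sinv r] is a point. *)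
rewrite -[r in r <= _]sinvK in nr.
have := sr (exist _ (sinv r) nr); rewrite /points_not_above /= lexx.
by rewrite sinv_leC sinvK => /(_ nrs).
Qed.

End PointRepresentation.

Theorem theorem3p2 (d : Order.disp_t) (S : separationSystemType d) :
  implementable S <-> scrupulous S.
Proof.
split=> [[V [A isoSA]]|scrS].
  apply: scrupulous_isomorphic isoSA _.
  exact/scrupulous_subsystem/scrupulous_setsep.
exists (@point d S); eexists.
exact: isomorphic_range (point_separation_le scrS) point_separationV.
Qed.
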